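(* Let $G$ be a finite simple disconnected graph with no isolated vertices whose connected components consist of bipartite graphs $H_1,\ldots,H_b$ and non-bipartite graphs $G_1,\ldots,G_r$, where $b\ge 0$ and $r \ge 1$. Let $c(G) = b + r$ denote the number of connected components of $G$, and let $I(G)\subseteq K[x_1,\ldots,x_n]$ be the edge ideal of $G$ over a field $K$. Then, for all sufficiently large integers $k$, $$2k - 1 \le \mathrm{v}(\overline{I(G)^k}) \le 2k + b - 1 \le \mathrm{v}(I(G)^k) = 2k + c(G) - 2.$$
   Context: For a finite simple graph $G$ with vertex set $V(G)=\{x_1,\ldots,x_n\}$ and edge set $E(G)$, the edge ideal is $I(G)=(x_ix_j : \{x_i,x_j\}\in E(G))\subseteq R=K[x_1,\ldots,x_n]$, with $R$ standard graded. For a proper homogeneous ideal $I\subseteq R$, the v-number of $I$ is $$\mathrm{v}(I)=\min\{d\ge 0 : \text{there exist } f\in R_d \text{ and } \mathfrak p\in\operatorname{Ass}(I) \text{ such that } (I:f)=\mathfrak p\},$$ where $R_d$ is the space of homogeneous polynomials of degree $d$, $(I:f)=\{g\in R: gf\in I\}$, and $\operatorname{Ass}(I)$ is the set of associated primes of $R/I$. The integral closure $\overline{I}$ of an ideal $I$ is the ideal of all $x\in R$ satisfying an equation $x^m+a_1x^{m-1}+\cdots+a_m=0$ with $m\ge 1$ and $a_i\in I^i$. *)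

(* Defs.v *)
From HB Require Import structures.
From mathcomp Require Import all_boot all_order all_algebra.
From mathcomp Require Import mpoly.

Set Implicit Arguments.
Unset Strict Implicit.
Unset Printing Implicit Defensive.

Import GRing.Theory.
Local Open Scope ring_scope.

Section Ideals.
Variable R : comNzRingType.
(* Ideals are Prop-valued predicates: membership need not be decidable. *)
Implicit Types (I p : R -> Prop) (f g : R).

Definition is_ideal I : Prop :=
  [/\ I 0, forall f g, I f -> I g -> I (f + g) & forall f g, I g -> I (f * g)].

Definition is_prime_ideal p : Prop :=
  [/\ is_ideal p, ~ p 1 & forall f g, p (f * g) -> p f \/ p g].

Definition ideal_gen (S : R -> Prop) : R -> Prop := fun f =>
  exists (m : nat) (a s : 'I_m -> R),
    (forall i, S (s i)) /\ f = \sum_(i < m) a i * s i.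

(* For k = 0 the only generator is the empty product, so I^0 is the unit
   ideal. *)
Definition ideal_pow I (k : nat) : R -> Prop :=
  ideal_gen (fun f =>
    exists s : 'I_k -> R, (forall i, I (s i)) /\ f = \prod_(i < k) s i).

Definition colon I f : R -> Prop := fun g => I (g * f).

Definition associated_prime I p : Prop :=
  is_prime_ideal p /\ exists f, forall g, p g <-> colon I f g.

Definition integral_closure I : R -> Prop := fun x =>
  exists (m : nat) (a : nat -> R),
    [/\ (0 < m)%N,
        forall i, (1 <= i <= m)%N -> ideal_pow I i (a i)
      & x ^+ m + \sum_(1 <= i < m.+1) a i * x ^+ (m - i) = 0].

End Ideals.

Section VNumber.
Variables (K : fieldType) (n : nat).
Implicit Types (I : {mpoly K[n]} -> Prop).

Definition vnumber_witness I (d : nat) : Prop :=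
  exists (f : {mpoly K[n]}) (p : {mpoly K[n]} -> Prop),
    [/\ f \is d.-homog, associated_prime I p
      & forall g, colon I f g <-> p g].

(* The minimum is attained at d; in particular [is_vnumber I d] asserts that
   the set of admissible degrees is nonempty. *)
Definition is_vnumber I (d : nat) : Prop :=
  vnumber_witness I d /\ forall d', vnumber_witness I d' -> (d <= d')%N.

End VNumber.

Record sgraph (n : nat) := SGraph {
  adj :> rel 'I_n;
  adj_sym : ssrbool.symmetric adj;
  adj_irrefl : irreflexive adj
}.

Section Graphs.
Variables (n : nat) (G : sgraph n).

Definition no_isolated : Prop := forall x, exists y, G x y.

Definition disconnected : Prop := exists x y, ~~ connect G x y.

Definition components : {set {set 'I_n}} :=
  equivalence_partition (connect G) [set: 'I_n].

(* Bipartiteness of the subgraph induced on C, with parts C :&: A and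
   C :\: A. *)
Definition bipartite_on (C : {set 'I_n}) : bool :=
  [exists A : {set 'I_n},
    [forall x in C, forall y in C, G x y ==> ((x \in A) != (y \in A))]].

Definition num_components : nat := #|components|.

Definition num_bipartite : nat := #|[set C in components | bipartite_on C]|.

Definition num_nonbipartite : nat :=
  #|[set C in components | ~~ bipartite_on C]|.

Definition edge_ideal (K : fieldType) : {mpoly K[n]} -> Prop :=
  ideal_gen (fun f => exists i j : 'I_n, G i j /\ f = 'X_i * 'X_j).

End Graphs.
Arguments edge_ideal {n} G K _.

(* Main.v *)
Require Import Defs.
From HB Require Import structures.
From mathcomp Require Import all_boot all_order all_algebra.
From mathcomp Require Import mpoly.
From mathcomp Require Import zify ring.
From Stdlib Require Import Classical_Prop.

(* A monomial lies in I(G)^k exactly when a product of k edges divides it, so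
   everything is read off the supports of polynomials.  Fix a root r_C in each
   component C.  If x is joined to y by a walk of odd length, its alternate
   edges show that x y times the product of the l "inner" edges is a product of
   l + 1 edges; hence some product M of edges absorbs all odd walks at once:
   x y M is in I^(deg M / 2 + 1) whenever an odd walk joins x to y.

   Upper bounds.  Give weight 1 to the vertices of non-bipartite components and,
   in a bipartite C, weight 2 or 0 according to the side, the side of r_C having
   weight 0; then each edge has weight 2.  The elements of positive weighted
   order form the prime p generated by the vertices of positive weight.  For I^k
   the colon of (prod_C r_C) M is p, since the edges available in each component
   are limited by the weight there.  For the integral closure it suffices to
   keep the roots of the bipartite components and of one non-bipartite
   component: the weighted order is a valuation, and (x f)^2 is in I^(2k) for
   every variable x in p; sums of such elements are integral because integral
   elements over the Rees algebra form a ring.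

   Lower bounds.  For the closure, compare degrees.  For I^k, some monomial m of
   f is not in I^k, while every component C contains a vertex x with x m in I^k;
   an exchange argument shows that the edges used inside C outnumber by one
   those used in C for another component, so m has degree at least
   2(k - 1) + c. *)

Set Implicit Arguments.
Unset Strict Implicit.
Unset Printing Implicit Defensive.

Import GRing.Theory.
Local Open Scope ring_scope.

Lemma ideal_gen_sub (R : comNzRingType) (S I : R -> Prop) :
  is_ideal I -> (forall f, S f -> I f) -> forall f, ideal_gen S f -> I f.
Proof.
case=> I0 ID IM SI f [m [a [s [Ss ->]]]].
by elim/big_ind: _ => // i _; apply/IM/SI.
Qed.

(** * Weighted orders of polynomials *)

Section MonomialSupport.
Variables (n : nat) (K : fieldType).
Implicit Types (E : pred 'X_{1..n}) (f g : {mpoly K[n]}).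

(** For a monomial ideal, [E] is its set of exponents and this is membership. All ideals below
    except the integral closure take this boolean form. *)
Definition supp_in E f : bool := all E (msupp f).

Lemma supp_in0 E : supp_in E 0.
Proof. by rewrite /supp_in msupp0. Qed.

Lemma supp_inD E f g : supp_in E f -> supp_in E g -> supp_in E (f + g).
Proof.
move=> /allP Ef /allP Eg; apply/allP => m /msuppD_le.
by rewrite mem_cat => /orP[/Ef|/Eg].
Qed.

Lemma supp_in_sum E (I : Type) (r : seq I) (P : pred I) (F : I -> {mpoly K[n]}) :
  (forall i, P i -> supp_in E (F i)) -> supp_in E (\sum_(i <- r | P i) F i).
Proof.
move=> EF; elim/big_rec: _ => [|i f Pi Ef]; first exact: supp_in0.
by apply: supp_inD; auto.
Qed.

Lemma supp_in_sum_seq E (I : eqType) (r : seq I) (F : I -> {mpoly K[n]}) :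
  (forall i, i \in r -> supp_in E (F i)) -> supp_in E (\sum_(i <- r) F i).
Proof. by move=> EF; rewrite big_seq_cond; apply: supp_in_sum => i /andP[/EF]. Qed.

Lemma supp_inN E f : supp_in E (- f) = supp_in E f.
Proof. by rewrite /supp_in (perm_all _ (msuppN f)). Qed.

Lemma supp_inX E m : supp_in E 'X_[m] = E m.
Proof. by rewrite /supp_in msuppX /= andbT. Qed.

Lemma supp_inM E1 E2 E3 f g :
  (forall a b, E1 a -> E2 b -> E3 (a + b)%MM) ->
  supp_in E1 f -> supp_in E2 g -> supp_in E3 (f * g).
Proof.
move=> E123 /allP E1f /allP E2g; apply/allP => m.
move=> /msuppM_le /allpairsP[[a b]] /= [af bg ->].
by apply: E123; auto.
Qed.

Lemma sub_supp_in E1 E2 f : subpred E1 E2 -> supp_in E1 f -> supp_in E2 f.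
Proof. by move=> E12; apply: sub_all. Qed.

Lemma supp_in_MX E f m : supp_in E (f * 'X_[m]) = all (fun a => E (a + m)%MM) (msupp f).
Proof.
rewrite /supp_in (perm_all _ (msuppMX f m)) all_map; apply: eq_all => a /=.
by rewrite addmC.
Qed.

End MonomialSupport.

Section Weights.
Variables (n : nat) (K : fieldType) (w : 'I_n -> nat).
Implicit Types (f g : {mpoly K[n]}) (m : 'X_{1..n}).

Definition wt m : nat := (\sum_i w i * m i)%N.

Lemma wtD m1 m2 : wt (m1 + m2)%MM = (wt m1 + wt m2)%N.
Proof. by rewrite /wt -big_split; apply: eq_bigr => i _; rewrite mnmDE mulnDr. Qed.

Lemma wt0 : wt 0%MM = 0%N.
Proof. by rewrite /wt big1 // => i _; rewrite mnm0E muln0. Qed.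

Lemma wtU i : wt U_(i)%MM = w i.
Proof.
rewrite /wt (bigD1 i) //= mnm1E eqxx muln1 big1 ?addn0 // => j ji.
by rewrite mnm1E eq_sym (negPf ji) muln0.
Qed.

Lemma wt_sum (I : Type) (r : seq I) (P : pred I) (F : I -> 'X_{1..n}) :
  wt (\sum_(i <- r | P i) F i)%MM = (\sum_(i <- r | P i) wt (F i))%N.
Proof. exact: (big_morph _ wtD wt0). Qed.

Lemma wt_le m1 m2 : (m1 <= m2)%MM -> (wt m1 <= wt m2)%N.
Proof.
by move=> /mnm_lepP le12; apply: leq_sum => i _; rewrite leq_mul2l le12 orbT.
Qed.

Definition wt_ge d : {mpoly K[n]} -> bool := supp_in [pred m | d <= wt m]%N.

Lemma wt_ge0 f : wt_ge 0 f.
Proof. by apply/allP. Qed.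

Lemma wt_geM a b f g : wt_ge a f -> wt_ge b g -> wt_ge (a + b) (f * g).
Proof. by apply: supp_inM => m1 m2 /=; rewrite wtD; exact: leq_add. Qed.

Lemma wt_ge_leq a b f : (a <= b)%N -> wt_ge b f -> wt_ge a f.
Proof. by move=> ab; apply: sub_supp_in => m /=; exact: leq_trans. Qed.

Lemma wt_ge_exists f d : ~~ wt_ge d f ->
  exists a, [/\ (a < d)%N, wt_ge a f & ~~ wt_ge a.+1 f].
Proof.
elim: d => [|d IH]; first by rewrite wt_ge0.
move=> fd; have [fd'|/IH[a [ad fa fa1]]] := boolP (wt_ge d f); first by exists d.
by exists a; split=> //; apply: ltnW.
Qed.

(** The part [f0] of lowest weight is split off so that orders of products can be read on it. *)
Lemma initial_form a f : wt_ge a f -> ~~ wt_ge a.+1 f ->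
  exists f0 f1, [/\ f = f0 + f1, f0 != 0,
    supp_in [pred m | wt m == a] f0 & wt_ge a.+1 f1].
Proof.
move=> fa fa1.
exists (\sum_(m <- msupp f | wt m == a) f@_m *: 'X_[m]).
exists (\sum_(m <- msupp f | wt m != a) f@_m *: 'X_[m]).
split.
- by rewrite {1}[f]mpolyE (bigID (fun m => wt m == a)).
- apply: contra fa1 => /eqP f0; rewrite [f]mpolyE.
  rewrite (bigID (fun m => wt m == a)) /= f0 add0r.
  rewrite big_seq_cond; apply: supp_in_sum => m /andP[mf ma].
  apply/allP => m' /msuppZ_le /mem_msuppXP <- /=.
  by rewrite ltn_neqAle eq_sym ma; move/allP: fa; apply.
- apply: supp_in_sum => m ma; apply/allP => m' /msuppZ_le /mem_msuppXP <- //.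
- rewrite big_seq_cond; apply: supp_in_sum => m /andP[mf ma].
  apply/allP => m' /msuppZ_le /mem_msuppXP <- /=.
  by rewrite ltn_neqAle eq_sym ma; move/allP: fa; apply.
Qed.

(** The polynomial ring is a domain, so the product of the initial forms is nonzero. Hence the
    weighted order is additive, that is, a valuation. *)
Lemma wt_gtM a b f g : wt_ge a f -> ~~ wt_ge a.+1 f -> wt_ge b g -> ~~ wt_ge b.+1 g ->
  ~~ wt_ge (a + b).+1 (f * g).
Proof.
move=> fa fa1 gb gb1.
have [f0 [f1 [def_f f0n0 wf0 wf1]]] := initial_form fa fa1.
have [g0 [g1 [def_g g0n0 wg0 wg1]]] := initial_form gb gb1.
have w0 c h : supp_in [pred m | wt m == c] h -> wt_ge c h.
  by apply: sub_supp_in => m /= /eqP ->.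
apply/negP => wfg.
have : wt_ge (a + b).+1 (f0 * g0).
  have -> : f0 * g0 = f * g + - (f0 * g1 + f1 * g) by rewrite def_f def_g; ring.
  apply: supp_inD => //; rewrite supp_inN; apply: supp_inD.
    by rewrite -addnS; apply: wt_geM => //; apply: w0.
  by rewrite -addSn; apply: wt_geM.
have : supp_in [pred m | wt m == a + b]%N (f0 * g0).
  by move: wf0 wg0; apply: supp_inM => m1 m2 /= /eqP <- /eqP <-; rewrite wtD.
move=> /allP h1 /allP h2.
have : f0 * g0 != 0 by rewrite mulf_neq0.
move/mlead_supp => h; move: (h1 _ h) (h2 _ h) => /= /eqP ->.
by rewrite ltnn.
Qed.

Lemma wt_geX a f (m : nat) : wt_ge a f -> wt_ge (a * m) (f ^+ m).
Proof.
move=> fa; elim: m => [|m IH]; first by rewrite muln0 wt_ge0.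
by rewrite mulnS exprS; apply: wt_geM.
Qed.

Lemma wt_gtX a f (m : nat) :
  wt_ge a f -> ~~ wt_ge a.+1 f -> ~~ wt_ge (a * m).+1 (f ^+ m).
Proof.
move=> fa fa1; elim: m => [|m IH].
  by rewrite muln0 expr0 -mpolyX0 /wt_ge supp_inX /= wt0.
by rewrite mulnS exprS; apply: wt_gtM => //; apply: wt_geX.
Qed.

Lemma wt_ge_ideal d : is_ideal (wt_ge d).
Proof.
split=> [|f g|f g gd]; [exact: supp_in0 | exact: supp_inD |].
by rewrite -[d]add0n; apply: wt_geM => //; apply: wt_ge0.
Qed.

(** Primality is additivity of the order for two factors of order zero. *)
Lemma wt_ge1_prime : is_prime_ideal (wt_ge 1).
Proof.
split; first exact: wt_ge_ideal.
  by apply/negP; rewrite -mpolyX0 /wt_ge supp_inX /= wt0.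
move=> f g fg; have [|f1] := boolP (wt_ge 1 f); first by left.
right; apply/negPn/negP => g1.
by move: (wt_gtM (wt_ge0 f) f1 (wt_ge0 g) g1); rewrite fg.
Qed.

Lemma wt_ge_ideal_pow d k (I : {mpoly K[n]} -> Prop) :
  (forall f, I f -> wt_ge d f) -> forall f, ideal_pow I k f -> wt_ge (d * k) f.
Proof.
move=> Id; apply: ideal_gen_sub; first exact: wt_ge_ideal.
move=> _ [s [Is ->]]; elim: k s Is => [|k IH] s Is; first by rewrite muln0 wt_ge0.
by rewrite big_ord_recl mulnS; apply: wt_geM; [exact: Id|apply: IH].
Qed.

(** If [f] had order [e < d], then [f ^+ m] would have order exactly [e * m]. The other terms of the
    equation have order at least [d * i + e * (m - i)], which is larger because [i] is positive. *)
Lemma wt_ge_integral_closure d (I : {mpoly K[n]} -> Prop) :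
  (forall f, I f -> wt_ge d f) -> forall f, integral_closure I f -> wt_ge d f.
Proof.
move=> Id f [m [a [m0 Ia /eqP]]]; rewrite addr_eq0 => /eqP fm.
apply/negPn/negP => /wt_ge_exists[e [ed fe fe1]].
have /negP := wt_gtX m fe fe1; apply; rewrite fm /wt_ge supp_inN.
apply: supp_in_sum_seq => i; rewrite mem_index_iota ltnS => i1m.
have /andP[i0 im] := i1m.
apply: (wt_ge_leq _ (wt_geM (wt_ge_ideal_pow Id (Ia i i1m)) (wt_geX (m - i) fe))).
rewrite -{1}(subnKC im) mulnDr -addSn leq_add2r ltn_mul2r.
by rewrite i0.
Qed.

End Weights.

(** * Powers of edge ideals *)

Section IdealGeneration.
Variable R : comNzRingType.
Implicit Types (S I J : R -> Prop).

Lemma ideal_gen_mem S f : S f -> ideal_gen S f.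
Proof.
move=> Sf; exists 1, (fun=> 1), (fun=> f); split=> //.
by rewrite big_ord1 mul1r.
Qed.

Lemma ideal_gen_ideal S : is_ideal (ideal_gen S).
Proof.
split.
- by exists 0, (fun=> 0), (fun=> 0); split; [case|rewrite big_ord0].
- move=> _ _ [m1 [a1 [s1 [S1 ->]]]] [m2 [a2 [s2 [S2 ->]]]].
  pose glue (u : 'I_m1 -> R) (v : 'I_m2 -> R) (i : 'I_(m1 + m2)) :=
    match split i with inl j => u j | inr j => v j end.
  exists (m1 + m2)%N, (glue a1 a2), (glue s1 s2); split.
    by move=> i; rewrite /glue; case: (split i).
  have glueL u v j : glue u v (lshift m2 j) = u j.
    by rewrite /glue (unsplitK (inl j : 'I_m1 + 'I_m2)).
  have glueR u v j : glue u v (rshift m1 j) = v j.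
    by rewrite /glue (unsplitK (inr j : 'I_m1 + 'I_m2)).
  rewrite big_split_ord /=.
  by congr (_ + _); apply: eq_bigr => j _; rewrite ?glueL ?glueR.
- move=> f _ [m [a [s [Ss ->]]]]; exists m, (fun i => f * a i), s; split=> //.
  by rewrite mulr_sumr; apply: eq_bigr => i _; rewrite mulrA.
Qed.

Lemma sub_ideal_pow I J k f :
  (forall g, I g -> J g) -> ideal_pow I k f -> ideal_pow J k f.
Proof.
move=> IJ [m [a [s [Ss ->]]]]; exists m, a, s; split=> // i.
by have [t [It ->]] := Ss i; exists t; split=> // j; apply: IJ.
Qed.

End IdealGeneration.

Section EdgeMonomials.
Variables (n : nat) (G : sgraph n).
Implicit Types (s : seq ('I_n * 'I_n)) (m : 'X_{1..n}).

Definition emon s : 'X_{1..n} := (\sum_(e <- s) (U_(e.1) + U_(e.2)))%MM.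

Definition edges s : bool := all (fun e => G e.1 e.2) s.

(** Quantifying over tuples of fixed length keeps this boolean, as [supp_in] requires. *)
Definition edge_dvd k m : bool :=
  [exists t : k.-tuple ('I_n * 'I_n), edges t && (emon t <= m)%MM].

Lemma edge_dvdP k m :
  reflect (exists s, [/\ size s = k, edges s & (emon s <= m)%MM]) (edge_dvd k m).
Proof.
apply: (iffP existsP) => [[t /andP[te tm]]|[s [sk se sm]]].
  by exists t; rewrite size_tuple.
by move/eqP: sk => sk; exists (Tuple sk); rewrite /= se.
Qed.

Lemma emon_nil : emon [::] = 0%MM.
Proof. exact: big_nil. Qed.

Lemma emon_cat s1 s2 : emon (s1 ++ s2) = (emon s1 + emon s2)%MM.
Proof. exact: big_cat. Qed.

Lemma emon_cons e s : emon (e :: s) = (U_(e.1) + U_(e.2) + emon s)%MM.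
Proof. exact: big_cons. Qed.

Lemma mdeg_emon s : mdeg (emon s) = (2 * size s)%N.
Proof.
elim: s => [|e s IH]; first by rewrite emon_nil mdeg0.
by rewrite emon_cons !mdegD !mdeg1 IH /= mulnS.
Qed.

Lemma edges_cat s1 s2 : edges (s1 ++ s2) = edges s1 && edges s2.
Proof. exact: all_cat. Qed.

Lemma edge_dvd0 m : edge_dvd 0 m.
Proof.
apply/edge_dvdP; exists [::]; rewrite emon_nil; split=> //.
by apply/mnm_lepP => i; rewrite mnm0E.
Qed.

Lemma edge_dvdD k l a b : edge_dvd k a -> edge_dvd l b -> edge_dvd (k + l) (a + b)%MM.
Proof.
move=> /edge_dvdP[s [<- se sa]] /edge_dvdP[t [<- te tb]]; apply/edge_dvdP.
exists (s ++ t); rewrite size_cat edges_cat se te emon_cat; split=> //.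
by apply/mnm_lepP => i; rewrite !mnmDE leq_add //; apply/mnm_lepP.
Qed.

Lemma edge_dvd_le k a b : (a <= b)%MM -> edge_dvd k a -> edge_dvd k b.
Proof.
move=> ab /edge_dvdP[s [sk se sa]]; apply/edge_dvdP; exists s; split=> //.
exact: lepm_trans ab.
Qed.

Lemma edge_dvd_emon s : edges s -> edge_dvd (size s) (emon s).
Proof. by move=> se; apply/edge_dvdP; exists s; rewrite lepm_refl. Qed.

(** The list of [k * i] edges is cut into [i] blocks of [k] edges. *)
Lemma edge_dvd_split k i m : edge_dvd (k * i) m ->
  exists t : 'I_i -> 'X_{1..n}, (forall j, edge_dvd k (t j)) /\ (\sum_j t j <= m)%MM.
Proof.
move=> /edge_dvdP[s [ski se sm]].
suff [t [tk tE]] : exists t : 'I_i -> 'X_{1..n},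
    (forall j, edge_dvd k (t j)) /\ (\sum_j t j)%MM = emon s.
  by exists t; split=> //; rewrite tE.
elim: i s ski se {sm} => [|i IH] s ski se.
  exists (fun=> 0%MM); split; first by case.
  by move: ski; rewrite muln0 => /size0nil ->; rewrite big_ord0 emon_nil.
move: se; rewrite -{1}(cat_take_drop k s) edges_cat => /andP[se1 se2].
have [||t [tk tE]] := IH (drop k s); [by rewrite size_drop ski mulnS addKn|by []|].
exists (fun j => oapp t (emon (take k s)) (unlift ord0 j)); split.
  move=> j; case: (unlift ord0 j) => //=.
  by have := edge_dvd_emon se1; rewrite size_takel // ski mulnS leq_addr.
rewrite big_ord_recl unlift_none /= -[in RHS](cat_take_drop k s) emon_cat.
by rewrite -tE; congr (_ + _)%MM; apply: eq_bigr => j _; rewrite liftK.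
Qed.

End EdgeMonomials.

Section EdgePowers.
Variables (n : nat) (G : sgraph n) (K : fieldType).
Implicit Types (f g : {mpoly K[n]}) (m : 'X_{1..n}).

Definition edge_pow k : {mpoly K[n]} -> bool := supp_in (edge_dvd G k).

Lemma edge_powM k l f g : edge_pow k f -> edge_pow l g -> edge_pow (k + l) (f * g).
Proof. by apply: supp_inM => a b; apply: edge_dvdD. Qed.

Lemma edge_pow0 f : edge_pow 0 f.
Proof. by apply/allP => m _; apply: edge_dvd0. Qed.

Lemma edge_pow_ideal k : is_ideal (edge_pow k).
Proof.
split=> [|f g|f g gk]; [exact: supp_in0 | exact: supp_inD |].
by rewrite -[k]add0n; apply: edge_powM => //; apply: edge_pow0.
Qed.

Lemma supp_in_ideal (E : pred 'X_{1..n}) (I : {mpoly K[n]} -> Prop) :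
  is_ideal I -> (forall m, E m -> I 'X_[m]) -> forall f, supp_in E f -> I f.
Proof.
case=> I0 ID IM EI f /allP Ef; rewrite [f]mpolyE big_seq.
elim/big_ind: _ => // m mf; rewrite -mul_mpolyC; apply: IM; apply: EI.
exact: Ef.
Qed.

(** An integral equation over the [k]-th power of the edge ideal has coefficients in powers of that
    power, so iterated powers are needed. *)
Lemma ideal_pow_edge_pow k i f :
  ideal_pow (edge_pow k : {mpoly K[n]} -> Prop) i f <-> edge_pow (k * i) f.
Proof.
split.
  apply: (ideal_gen_sub (edge_pow_ideal _)).
  move=> _ [s [Is ->]]; elim: i s Is => [|i IH] s Is; first by rewrite muln0 edge_pow0.
  by rewrite big_ord_recl mulnS; apply: edge_powM => //; apply: IH.
apply: (supp_in_ideal (ideal_gen_ideal _)).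
move=> m /edge_dvd_split[t [tk tm]].
have [_ _ IM] := ideal_gen_ideal (fun g => exists s : 'I_i -> {mpoly K[n]},
  (forall j, edge_pow k (s j)) /\ g = \prod_(j < i) s j).
rewrite -(submK tm) mpolyXD; apply/IM/ideal_gen_mem.
exists (fun j => 'X_[t j]); split; first by move=> j; rewrite /edge_pow supp_inX.
exact: (big_morph _ (mpolyXD K) (mpolyX0 _ K)).
Qed.

Lemma edge_idealE f : edge_ideal G K f <-> edge_pow 1 f.
Proof.
split.
  apply: (ideal_gen_sub (edge_pow_ideal _)).
  move=> _ [i [j [Gij ->]]]; rewrite -mpolyXD /edge_pow supp_inX.
  apply/edge_dvdP; exists [:: (i, j)]; rewrite emon_cons emon_nil addm0 lepm_refl.
  by split=> //=; rewrite Gij.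
apply: (supp_in_ideal (ideal_gen_ideal _)).
move=> m /edge_dvdP[[|[i j] [|? ?]] [] // _ /= /andP[Gij _]].
rewrite emon_cons emon_nil addm0 => ijm.
have [_ _ IM] := ideal_gen_ideal
  (fun f : {mpoly K[n]} => exists i j, G i j /\ f = 'X_i * 'X_j).
rewrite -(submK ijm) mpolyXD; apply/IM/ideal_gen_mem.
by exists i, j; rewrite mpolyXD.
Qed.

Lemma edge_ideal_powE k f : ideal_pow (edge_ideal G K) k f <-> edge_pow k f.
Proof.
rewrite -[k in edge_pow k]mul1n -ideal_pow_edge_pow.
by split; apply: sub_ideal_pow => g /edge_idealE.
Qed.

Lemma edge_ideal_pow_powE k i f :
  ideal_pow (ideal_pow (edge_ideal G K) k) i f <-> edge_pow (k * i) f.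
Proof.
rewrite -ideal_pow_edge_pow.
by split; apply: sub_ideal_pow => g /edge_ideal_powE.
Qed.

End EdgePowers.

(** * Integral closure and the Rees algebra *)

Section IntegralEquation.
Variables (R K : comNzRingType) (RtoK : {rmorphism R -> K}).

Lemma integral_sqr (c : R) (u : K) : RtoK c = u ^+ 2 -> integralOver RtoK u.
Proof.
move=> cu; exists ('X^2 - c%:P); first exact: monicXnsubC.
by rewrite rmorphB /= map_polyXn map_polyC /= cu /root !hornerE subrr.
Qed.

Lemma integral_equation (u : K) : integralOver RtoK u ->
  exists (m : nat) (c : nat -> R),
    (0 < m)%N /\ u ^+ m + \sum_(i < m) RtoK (c i) * u ^+ i = 0.
Proof.
case=> p pmon proot.
have [m sp] : exists m, size p = m.+1.
  by exists (size p).-1; rewrite prednK // size_poly_gt0 monic_neq0.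
have pm : p`_m = 1 by move/monicP: pmon; rewrite lead_coefE sp.
exists m, (fun i => p`_i); split.
  (* In degree zero the monic polynomial would be the constant 1, which has no root. *)
  rewrite lt0n; apply/eqP => m0; move: proot.
  have -> : p = 1 by rewrite (size1_polyC (_ : size p <= 1)%N) ?sp ?m0 // -m0 pm.
  by rewrite rmorph1 /= /root hornerC oner_eq0.
move/rootP: proot; rewrite horner_coef size_map_poly_id0; last first.
  by move/monicP: pmon => ->; rewrite rmorph1 oner_eq0.
rewrite sp big_ord_recr /= coef_map pm /= rmorph1 mul1r addrC => eq0.
by rewrite -[RHS]eq0; congr (_ + _); apply: eq_bigr => i _; rewrite coef_map.
Qed.

End IntegralEquation.

Section ReesAlgebra.
Variables (n : nat) (G : sgraph n) (K : fieldType) (k : nat).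

(** The Rees algebra of the [k]-th power of the edge ideal, inside the polynomials in one further
    variable. Bounding the index by the size makes the condition boolean. *)
Definition rees : {pred {poly {mpoly K[n]}}} :=
  [pred q : {poly {mpoly K[n]}} | [forall i : 'I_(size q), edge_pow G (k * i) q`_i]].

Lemma reesP (q : {poly {mpoly K[n]}}) :
  reflect (forall i, edge_pow G (k * i) q`_i) (q \in rees).
Proof.
apply: (iffP forallP) => [qi i|qi i]; last exact: qi.
have [iq|qi0] := ltnP i (size q); first exact: (qi (Ordinal iq)).
by rewrite nth_default // /edge_pow supp_in0.
Qed.

Lemma rees_subring : subring_closed rees.
Proof.
split.
- apply/reesP => -[|i]; first by rewrite muln0 edge_pow0.
  by rewrite coef1 /edge_pow supp_in0.
- move=> p q /reesP pi /reesP qi; apply/reesP => i; rewrite coefB.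
  by apply: supp_inD; rewrite ?supp_inN; [exact: pi|exact: qi].
- move=> p q /reesP pi /reesP qi; apply/reesP => i; rewrite coefM.
  apply: supp_in_sum => j _; rewrite -{1}(subnKC (ltn_ord j : j <= i)%N) mulnDr.
  exact: edge_powM.
Qed.

HB.instance Definition _ := GRing.isSubringClosed.Build _ rees rees_subring.

Definition rees_alg := {q : {poly {mpoly K[n]}} | q \in rees}.

HB.instance Definition _ := SubType.on rees_alg.
HB.instance Definition _ := Choice.on rees_alg.
HB.instance Definition _ := [SubChoice_isSubComNzRing of rees_alg by <:].

Definition rees_val : {rmorphism rees_alg -> {poly {mpoly K[n]}}} := \val.

Definition rees_elt (q : {poly {mpoly K[n]}}) (qr : q \in rees) : rees_alg :=
  exist _ q qr.

Lemma rees_integral_sqr (f : {mpoly K[n]}) :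
  edge_pow G (k * 2) (f ^+ 2) -> integralOver rees_val (f *: 'X).
Proof.
move=> f2.
have f2rees : f ^+ 2 *: 'X^2 \in rees.
  apply/reesP => i; rewrite coefZ coefXn; case: eqP => [->|_]; first by rewrite mulr1.
  by rewrite mulr0 /edge_pow supp_in0.
by apply: (integral_sqr (c := rees_elt f2rees)); rewrite exprZn.
Qed.

(** The degree-zero part of the Rees algebra is the whole ring, so constants such as [g] are
    integral over it. *)
Lemma rees_integral_mul (f g : {mpoly K[n]}) :
  integralOver rees_val (f *: 'X) -> integralOver rees_val ((g * f) *: 'X).
Proof.
move=> fint; rewrite -scalerA -mul_polyC; apply: integral_mul => //.
have gr : g%:P \in rees.
  apply/reesP => -[|i]; first by rewrite muln0 edge_pow0.
  by rewrite coefC /edge_pow supp_in0.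
exact: (integral_id rees_val (rees_elt gr)).
Qed.

(* In an equation of degree m for f 'X over the Rees algebra, the coefficients of
   'X^m give an equation of integral dependence for f. *)
Lemma rees_integral_closure (f : {mpoly K[n]}) :
  integralOver rees_val (f *: 'X) ->
  integral_closure (ideal_pow (edge_ideal G K) k) f.
Proof.
move=> /integral_equation[m [c [m0 ceq]]].
exists m, (fun i => (rees_val (c (m - i)%N))`_i); split=> //.
  by move=> i _; apply/edge_ideal_pow_powE; apply/reesP; apply: valP.
move/(congr1 (fun q : {poly {mpoly K[n]}} => q`_m)): ceq.
rewrite coef0 coefD exprZn coefZ coefXn eqxx mulr1 coef_sum => eq0.
rewrite -[RHS]eq0; congr (_ + _).
rewrite -(big_mkord xpredT (fun j => (rees_val (c j) * (f *: 'X) ^+ j)`_m)).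
(* The closure equation is indexed by the power of the ideal and the Rees equation by the power of
   [f]; reversing the sum matches them. *)
rewrite big_add1 [RHS]big_nat_rev add0n /= !big_mkord; apply: eq_bigr => i _.
rewrite exprZn -scalerAr coefZ coefMXn ltnNge leq_subr /= subKn //.
by rewrite mulrC.
Qed.

(** Multiplied by ['X], the summands are integral over the Rees algebra, where sums of integral
    elements are integral; this avoids building an equation for the sum by hand. *)
Lemma integral_closure_span (I : eqType) (r : seq I) (c y : I -> {mpoly K[n]}) :
  (forall i, i \in r -> edge_pow G (k * 2) (y i ^+ 2)) ->
  integral_closure (ideal_pow (edge_ideal G K) k) (\sum_(i <- r) c i * y i).
Proof.
move=> yr; apply: rees_integral_closure; rewrite scaler_suml.
rewrite big_seq; elim/big_ind: _ => [|*|i ir].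
- exact: integral0.
- exact: integral_add.
- by apply/rees_integral_mul/rees_integral_sqr/yr.
Qed.

End ReesAlgebra.

(** * Walks of odd length *)

Section DoubleCover.
Variables (n : nat) (G : sgraph n).
Implicit Types (x y z : 'I_n) (C : {set 'I_n}).

Definition double_cover : rel ('I_n * bool) :=
  fun u v => G u.1 v.1 && (u.2 != v.2).

(* Each step of a walk in G switches sheets in the bipartite double cover. *)
Definition odd_walk x y : bool := connect double_cover (x, false) (y, true).

Definition comp x : {set 'I_n} := [set y | connect G x y].

Lemma sgraph_connect_sym : connect_sym G.
Proof. exact/sym_connect_sym/adj_sym. Qed.

Lemma double_cover_connect_sym : connect_sym double_cover.
Proof. by apply: sym_connect_sym => u v; rewrite /double_cover adj_sym eq_sym. Qed.

Lemma double_cover_flip x a y b : connect double_cover (x, a) (y, b) ->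
  connect double_cover (x, ~~ a) (y, ~~ b).
Proof.
move=> /connectP[p]; elim: p x a => [|[z c] p IH] x a /=; first by move=> _ [-> ->].
move=> /andP[/andP[/= Gxz ac] zp] /(IH _ _ zp); apply: connect_trans.
by apply: connect1; rewrite /double_cover /= Gxz; move: ac; clear; case: a c => [] [].
Qed.

Lemma connect_double_cover x a y : connect G x y ->
  exists b, connect double_cover (x, a) (y, b).
Proof.
move=> /connectP[p]; elim: p x a => [|z p IH] x a /=; first by move=> _ ->; exists a.
move=> /andP[Gxz zp] /(IH z (~~ a) zp)[b zb]; exists b; apply: connect_trans zb.
by apply: connect1; rewrite /double_cover /= Gxz; case: a.
Qed.

(** The edges of the walk are put alternately into [s] and [t], so the inner vertices cancel.
    Prepending an edge changes the parity and exchanges the two forms of the identity. *)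
Lemma double_cover_monomial x a y b : connect double_cover (x, a) (y, b) ->
  exists s t, [/\ edges G s, edges G t &
  if a != b then size t = (size s).+1 /\ (U_(x) + U_(y) + emon s)%MM = emon t
  else size t = size s /\ (U_(y) + emon s)%MM = (U_(x) + emon t)%MM].
Proof.
move=> /connectP[p]; elim: p x a => [|[z c] p IH] x a /=.
  by move=> _ [-> ->]; exists [::], [::]; rewrite eqxx.
move=> /andP[/andP[/= Gxz ac] zp] /(IH _ _ zp)[s [t [se te]]].
have -> : (c != b) = ~~ (a != b) by move: ac; clear; case: a b c => [] [] [].
case: (a != b) => /= -[st stE].
  exists s, ((x, z) :: t); rewrite /= Gxz te; split=> //; split; first by rewrite /= st.
  by rewrite emon_cons /= -!addmA stE.
exists ((x, z) :: s), t; rewrite /= Gxz se; split=> //; split; first by rewrite /= st.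
rewrite emon_cons /= -stE.
by apply/mnmP => i; rewrite !mnmDE; lia.
Qed.

Lemma odd_walk_monomial x y : odd_walk x y -> exists s t,
  [/\ edges G s, edges G t, size t = (size s).+1 &
      (U_(x) + U_(y) + emon s)%MM = emon t].
Proof.
by move=> /double_cover_monomial[s [t [se te [st stE]]]]; exists s, t.
Qed.

Lemma componentsP C : reflect (exists x, C = comp x) (C \in components G).
Proof.
have compE x : [set y in [set: 'I_n] | connect G x y] = comp x.
  by apply/setP => y; rewrite !inE.
apply: (iffP imsetP) => [[x _ ->]|[x ->]]; exists x; rewrite ?compE //.
Qed.

Lemma mem_comp x : x \in comp x. Proof. by rewrite inE. Qed.

Lemma comp_eq x y : connect G x y -> comp x = comp y.
Proof.
move=> xy; apply/setP => z.
by rewrite !inE (same_connect sgraph_connect_sym xy).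
Qed.

Lemma mem_component C x : C \in components G -> (x \in C) = (C == comp x).
Proof.
move=> /componentsP[y ->]; apply/idP/eqP => [|->]; last exact: mem_comp.
by rewrite inE => /comp_eq.
Qed.

Lemma component_connect C x y :
  C \in components G -> x \in C -> y \in C -> connect G x y.
Proof.
move=> Cc xC yC; have : y \in comp x by move: xC; rewrite mem_component // => /eqP <-.
by rewrite inE.
Qed.

Lemma comp_in_components x : comp x \in components G.
Proof. by apply/componentsP; exists x. Qed.

Lemma edge_comp x y : G x y -> comp x = comp y.
Proof. by move=> Gxy; apply/comp_eq/connect1. Qed.

Lemma bipartite_onP C :
  reflect (exists A : {set 'I_n}, forall x y, x \in C -> y \in C -> G x y ->
             (x \in A) != (y \in A)) (bipartite_on G C).
Proof.
apply: (iffP existsP) => -[A AP]; exists A.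
  move=> x y xC yC Gxy.
  move/forallP: AP => /(_ x); rewrite xC => /forallP /(_ y).
  by rewrite yC Gxy.
apply/'forall_implyP => x xC; apply/'forall_implyP => y yC; apply/implyP => Gxy.
exact: AP.
Qed.

(** Each step of a walk switches both the side of the bipartition and the sheet, so their sum modulo
    2 is constant. *)
Lemma bipartite_double_cover (A : {set 'I_n}) C x a y b :
    C \in components G -> x \in C ->
    (forall x y, x \in C -> y \in C -> G x y -> (x \in A) != (y \in A)) ->
  connect double_cover (x, a) (y, b) -> (x \in A) (+) a = (y \in A) (+) b.
Proof.
move=> Cc xC AP /connectP[p].
elim: p x a xC => [|[z c] p IH] x a xC /=; first by move=> _ [-> ->].
move=> /andP[/andP[/= Gxz ac] zp] pl.
have zC : z \in C by move: xC; rewrite !mem_component // (edge_comp Gxz).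
rewrite -(IH _ _ zC zp pl).
move: (AP x z xC zC Gxz) ac; clear.
by case: (x \in A) (z \in A) a c => [] [] [] [].
Qed.

Lemma bipartite_odd_walk_refl C x :
  C \in components G -> x \in C -> bipartite_on G C -> ~~ odd_walk x x.
Proof.
move=> Cc xC /bipartite_onP[A AP]; apply/negP => /(bipartite_double_cover Cc xC AP).
by case: (x \in A).
Qed.

Lemma bipartite_odd_walk_edge C r x y : C \in components G -> r \in C -> x \in C ->
  bipartite_on G C -> G x y -> odd_walk r x (+) odd_walk r y.
Proof.
move=> Cc rC xC /bipartite_onP[A AP] Gxy.
have ryx b : connect double_cover (r, false) (x, b) ->
    connect double_cover (r, false) (y, ~~ b).
  by move/connect_trans; apply; apply: connect1; rewrite /double_cover /= Gxy; case: b.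
have oddE z b : connect double_cover (r, false) (z, b) -> odd_walk r z = b.
  move=> rz; apply/idP/idP => [rz1|b1]; last by rewrite b1 in rz.
  have := bipartite_double_cover Cc rC AP rz1.
  rewrite (bipartite_double_cover Cc rC AP rz).
  by case: (z \in A) b {rz} => [] [].
have [b rx] := connect_double_cover false (component_connect Cc rC xC).
by rewrite (oddE _ _ rx) (oddE _ _ (ryx _ rx)); case: (b).
Qed.

(** If no odd walk joined [x] to [y], the vertices reached from [x] by odd walks would form one side
    of a bipartition of [C]. *)
Lemma nonbipartite_odd_walk C x y : C \in components G -> x \in C -> y \in C ->
  ~~ bipartite_on G C -> odd_walk x y.
Proof.
move=> Cc xC yC; apply: contraR => nxy.
have even z : z \in C -> ~~ odd_walk x z -> connect double_cover (x, false) (z, false).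
  move=> /(component_connect Cc xC)/(connect_double_cover false)[[]] // xz.
  by rewrite /odd_walk xz.
have step z z' b c : G z z' -> connect double_cover (x, b) (z, c) ->
    connect double_cover (x, b) (z', ~~ c).
  move=> Gzz' /connect_trans; apply; apply: connect1.
  by rewrite /double_cover /= Gzz'; case: c.
(* A closed odd walk at [x], followed by an even walk to [y], would be an odd walk from [x] to
   [y]. *)
have noloop : ~~ connect double_cover (x, false) (x, true).
  apply: contra (nxy) => xx; apply: connect_trans xx _.
  exact: double_cover_flip (even _ yC nxy).
apply/bipartite_onP; exists [set z | odd_walk x z] => z z' zC z'C Gzz'.
rewrite !inE; apply: contra noloop => /eqP.
have [xz /esym xz'|xz /esym /negbT xz'] := boolP (odd_walk x z).
  have := step _ _ _ _ Gzz' xz; move: xz' => /double_cover_flip /=.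
  rewrite double_cover_connect_sym => h1 h2.
  exact: connect_trans h2 h1.
by case/negP: xz'; apply: step Gzz' (even _ zC xz).
Qed.

End DoubleCover.

(** * Upper bounds *)

Section UpperBounds.
Variables (n : nat) (G : sgraph n) (K : fieldType) (r : {set 'I_n} -> 'I_n).
Hypothesis root_mem : forall C, C \in components G -> r C \in C.
Implicit Types (x y : 'I_n) (C D : {set 'I_n}) (M : seq ('I_n * 'I_n)).

(** Testing one endpoint suffices, since both ends of an edge lie in the same component. *)
Definition in_comp C (e : 'I_n * 'I_n) : bool := e.1 \in C.

Lemma wt_emon (u : 'I_n -> nat) (P : pred ('I_n * 'I_n)) s :
  (forall x y, G x y -> u x + u y = 2 * P (x, y))%N ->
  edges G s -> wt u (emon s) = (2 * count P s)%N.
Proof.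
move=> uP; elim: s => [|[x y] s IH] /=; first by rewrite emon_nil wt0.
by move=> /andP[Gxy /IH se]; rewrite emon_cons !wtD !wtU /= se (uP _ _ Gxy) mulnDr.
Qed.

Lemma sum_mem_component x : (\sum_(C in components G) (x \in C) = 1)%N.
Proof.
rewrite (bigD1 (comp G x)) ?comp_in_components //= mem_comp big1 // => C /andP[Cc Cx].
by rewrite (mem_component _ Cc) (negPf Cx).
Qed.

Lemma sum_count_component s : (\sum_(C in components G) count (in_comp C) s = size s)%N.
Proof.
elim: s => [|e s IH] /=; first by rewrite big1.
by rewrite big_split /= IH sum_mem_component.
Qed.

Definition root_wt x : nat :=
  (if bipartite_on G (comp G x) then 2 * odd_walk G (r (comp G x)) x else 1)%N.

Lemma root_wt_edge x y : G x y -> (root_wt x + root_wt y = 2)%N.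
Proof.
move=> Gxy; rewrite /root_wt -(edge_comp Gxy); case: ifP => // bip.
have Cc := comp_in_components G x.
have := bipartite_odd_walk_edge Cc (root_mem Cc) (mem_comp G x) bip Gxy.
by case: (odd_walk G _ x); case: (odd_walk G _ y).
Qed.

Lemma root_wt_root C : C \in components G -> root_wt (r C) = ~~ bipartite_on G C.
Proof.
move=> Cc; have := root_mem Cc; rewrite (mem_component _ Cc) => /eqP CE.
rewrite /root_wt -CE; case: ifP => // bip.
by rewrite (negPf (bipartite_odd_walk_refl Cc (root_mem Cc) bip)).
Qed.

(** In a bipartite component positive weight means an odd walk from the root, which is then
    reversed; in any other component all pairs of vertices are joined by odd walks. *)
Lemma root_wt_odd_walk x : (0 < root_wt x)%N -> odd_walk G x (r (comp G x)).
Proof.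
have Cc := comp_in_components G x.
rewrite /root_wt; case: ifP => [_|/negbT nbip _].
  rewrite muln_gt0 lt0b /= => rx.
  by have /= := double_cover_flip rx; rewrite double_cover_connect_sym.
exact: nonbipartite_odd_walk Cc (mem_comp G x) (root_mem Cc) nbip.
Qed.

Lemma wt_gt0 (u : 'I_n -> nat) a :
  (0 < wt u a)%N -> exists i, (0 < u i)%N && (U_(i) <= a)%MM.
Proof.
move=> ua; apply/existsP; apply: contraLR ua => /existsPn ua.
rewrite -eqn0Ngt /wt big1 // => i _; have := ua i.
by rewrite lep1mP negb_and -leqNgt leqn0 negbK => /orP[] /eqP ->; rewrite ?muln0.
Qed.

Definition absorbing M : Prop :=
  edges G M /\
  forall x y, odd_walk G x y -> edge_dvd G (size M).+1 (U_(x) + U_(y) + emon M)%MM.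

Lemma absorbing_cat M s : edges G s -> absorbing M -> absorbing (M ++ s).
Proof.
move=> se [Me Mabs]; split; first by rewrite edges_cat Me.
move=> x y xy; rewrite size_cat emon_cat -addSn addmA.
by apply: edge_dvdD; [exact: Mabs | exact: edge_dvd_emon].
Qed.

(** There are finitely many pairs of vertices. For each pair joined by an odd walk, the inner edges
    of one such walk are appended; pairs treated before stay absorbed. *)
Lemma absorbing_exists : exists M, absorbing M.
Proof.
suff absL (L : seq ('I_n * 'I_n)) : exists M, edges G M /\
    forall e, e \in L -> odd_walk G e.1 e.2 ->
      edge_dvd G (size M).+1 (U_(e.1) + U_(e.2) + emon M)%MM.
  have [M [Me Mabs]] := absL (enum {: 'I_n * 'I_n}); exists M; split=> // x y xy.
  by apply: (Mabs (x, y)) => //; rewrite mem_enum.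
elim: L => [|[x y] L [M [Me Mabs]]]; first by exists [::].
have [xy|nxy] := boolP (odd_walk G x y); last first.
  exists M; split=> // e; rewrite in_cons => /orP[/eqP ->|]; last exact: Mabs.
  by rewrite /= (negPf nxy).
have [s [t [se te st stE]]] := odd_walk_monomial xy.
exists (M ++ s); split; first by rewrite edges_cat Me.
move=> e; rewrite in_cons => /orP[/eqP ->|eL] ew; rewrite size_cat emon_cat.
  rewrite -addnS -st /= [(emon M + _)%MM]addmC addmA stE addnC.
  by apply: edge_dvdD; exact: edge_dvd_emon.
by rewrite -addSn addmA; apply: edge_dvdD; [exact: Mabs | exact: edge_dvd_emon].
Qed.

(** Padding with copies of one edge reaches every larger size, hence every sufficiently large
    exponent. *)
Lemma absorbing_size M x y k : absorbing M -> G x y -> (size M <= k)%N ->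
  exists2 M', absorbing M' & size M' = k.
Proof.
move=> Mabs Gxy Mk; exists (M ++ nseq (k - size M) (x, y)).
  by apply: absorbing_cat => //; rewrite /edges all_nseq /= Gxy orbT.
by rewrite size_cat size_nseq subnKC.
Qed.

Definition roots_mon (P : pred {set 'I_n}) : 'X_{1..n} :=
  (\sum_(C in components G | P C) U_(r C))%MM.

Lemma roots_mon_le (P : pred {set 'I_n}) C :
  C \in components G -> P C -> (U_(r C) <= roots_mon P)%MM.
Proof.
by move=> Cc PC; rewrite /roots_mon (bigD1 C) ?Cc //= lem_addr.
Qed.

Lemma absorbing_root M m i : absorbing M -> (U_(r (comp G i)) + emon M <= m)%MM ->
  (0 < root_wt i)%N -> edge_dvd G (size M).+1 (U_(i) + m)%MM.
Proof.
move=> [Me Mabs] rm /root_wt_odd_walk /Mabs; apply: edge_dvd_le; rewrite -addmA.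
apply/mnm_lepP => j; move/mnm_lepP: rm => /(_ j).
by rewrite !mnmDE leq_add2l.
Qed.

Lemma vnumber_witness_monomial (I : {mpoly K[n]} -> Prop) m :
  (forall g, I (g * 'X_[m]) <-> wt_ge root_wt 1 g) -> vnumber_witness I (mdeg m).
Proof.
move=> Im; exists 'X_[m], (wt_ge root_wt 1 : {mpoly K[n]} -> Prop); split=> //.
  by rewrite dhomogX.
split; first exact: wt_ge1_prime.
by exists 'X_[m] => g; split=> /Im.
Qed.

Lemma edge_ideal_pow_witness M : absorbing M ->
  vnumber_witness (ideal_pow (edge_ideal G K) (size M).+1)
    (2 * size M + num_components G).
Proof.
move=> Mabs; pose m := (roots_mon xpredT + emon M)%MM.
have -> : (2 * size M + num_components G = mdeg m)%N.
  rewrite /m mdegD addnC; congr (_ + _)%N.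
    rewrite /roots_mon mdeg_sum (eq_bigr (fun=> 1%N)) => [|C _]; last exact: mdeg1.
    by rewrite /num_components -sum1_card; apply: eq_bigl => C; rewrite andbT.
  by rewrite mdeg_emon.
apply: vnumber_witness_monomial => g; rewrite edge_ideal_powE.
rewrite /edge_pow supp_in_MX /wt_ge /supp_in.
suff -> : all (fun a => edge_dvd G (size M).+1 (a + m)%MM) (msupp g) =
          all [pred a | 0 < wt root_wt a]%N (msupp g) by [].
apply: eq_all => a /=; apply/idP/idP => [|/wt_gt0[i /andP[wi ia]]]; last first.
  apply: edge_dvd_le (absorbing_root Mabs (m := m) _ wi).
    by apply/mnm_lepP => j; rewrite !mnmDE leq_add2r; move/mnm_lepP: ia; apply.
  apply/mnm_lepP => j; rewrite !mnmDE leq_add2r; move: j; apply/mnm_lepP.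
  by apply: roots_mon_le => //; exact: comp_in_components.
(* If [a] had weight zero, no component could hold more edges of [s] than of [M], contradicting the
   sizes. *)
rewrite lt0n => /edge_dvdP[s [sM se sm]]; apply/negP => /eqP wa.
suff : (size s <= size M)%N by rewrite sM ltnn.
rewrite -!sum_count_component; apply: leq_sum => C Cc.
pose u x := if x \in C then root_wt x else 0%N.
have u_edge x y : G x y -> (u x + u y = 2 * in_comp C (x, y))%N.
  move=> Gxy; rewrite /u /in_comp /= !(mem_component _ Cc) -(edge_comp Gxy).
  by case: ifP => // _; rewrite root_wt_edge.
have := wt_le u sm; rewrite !wtD !(wt_emon u_edge) //; last by case: Mabs.
have -> : wt u a = 0%N.
  apply/eqP; rewrite -leqn0 -wa; apply: leq_sum => i _; rewrite leq_mul2r /u.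
  by case: ifP => _; rewrite ?leqnn ?orbT.
(* The weight [u] counts twice the edges in [C], so an excess of at most 1 from the roots leaves no
   room for another edge. *)
suff : (wt u (roots_mon xpredT) <= 1)%N by lia.
rewrite /roots_mon wt_sum (bigD1 C) ?Cc //= big1 => [|D /andP[/andP[Dc _] DC]].
  rewrite wtU /u (root_mem Cc) addn0 root_wt_root //.
  by case: (bipartite_on _ _).
rewrite wtU /u; case: ifP => //; have := root_mem Dc.
rewrite (mem_component _ Dc) (mem_component _ Cc).
by move=> /eqP <- /eqP CD; rewrite CD eqxx in DC.
Qed.

Lemma root_wt_integral_closure k (f : {mpoly K[n]}) :
  integral_closure (ideal_pow (edge_ideal G K) k) f -> wt_ge root_wt (2 * k) f.
Proof.
apply: wt_ge_integral_closure => {}f /edge_ideal_powE; apply: sub_supp_in.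
move=> m /edge_dvdP[s [<- se sm]] /=; apply: leq_trans (wt_le _ sm).
by rewrite (wt_emon (P := predT)) ?count_predT // => x y /root_wt_edge ->.
Qed.

Lemma integral_closure_witness M N : absorbing M -> N \in components G ->
  ~~ bipartite_on G N ->
  vnumber_witness (integral_closure (ideal_pow (edge_ideal G K) (size M).+1))
    (2 * size M + num_bipartite G + 1).
Proof.
move=> Mabs Nc Nnbip; have [Me Modd] := Mabs.
pose m := (U_(r N) + (roots_mon (bipartite_on G) + emon M))%MM.
have mN : (U_(r N) + emon M <= m)%MM.
  by apply/mnm_lepP => j; rewrite !mnmDE leq_add2l leq_addl.
have -> : (2 * size M + num_bipartite G + 1 = mdeg m)%N.
  rewrite /m !mdegD mdeg1 addnC; congr (1 + _)%N; rewrite addnC; congr (_ + _)%N.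
    rewrite /roots_mon mdeg_sum (eq_bigr (fun=> 1%N)) => [|C _]; last exact: mdeg1.
    by rewrite /num_bipartite -sum1_card; apply: eq_bigl => C; rewrite inE.
  by rewrite mdeg_emon.
(* With exponent [k = (size M).+1] this is [2 * k - 1], one short of what membership demands: the
   bipartite roots weigh 0 and [r N] weighs 1. *)
have wm : wt root_wt m = (2 * size M).+1.
  rewrite /m !wtD wtU root_wt_root // Nnbip (wt_emon (P := predT)) ?count_predT //.
    rewrite /roots_mon wt_sum big1 => [|C /andP[Cc bip]]; first by rewrite add0n add1n.
    by rewrite wtU root_wt_root // bip.
  by move=> x y /root_wt_edge ->.
apply: vnumber_witness_monomial => g; split.
  move/root_wt_integral_closure; rewrite /wt_ge supp_in_MX; apply: sub_all => a /=.
  by rewrite wtD wm; lia.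
move=> /allP g1.
(* [i a] is a variable of positive weight dividing the monomial [a]; on the support of [g] the
   default is never taken. *)
pose i a := odflt (r N) [pick i | (0 < root_wt i)%N && (U_(i) <= a)%MM].
have iP a : a \in msupp g -> (0 < root_wt (i a))%N && (U_(i a) <= a)%MM.
  by move=> /g1 /wt_gt0[j jP]; rewrite /i; case: pickP => [//|/(_ j)]; rewrite jP.
rewrite [g in g * _]mpolyE mulr_suml.
have -> : \sum_(a <- msupp g) g@_a *: 'X_[a] * 'X_[m] =
    \sum_(a <- msupp g) (g@_a *: 'X_[a - U_(i a)]) * 'X_[U_(i a) + m].
  rewrite big_seq [RHS]big_seq; apply: eq_bigr => a /iP /andP[_ ia].
  by rewrite -!scalerAl -!mpolyXD addmA submK.
apply: integral_closure_span => a /iP /andP[wi _].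
rewrite mpolyXn /edge_pow supp_inX mulmS mulm1n muln2 -addnn.
have [bip|nbip] := boolP (bipartite_on G (comp G (i a))).
  suff rm : (U_(r (comp G (i a))) + emon M <= m)%MM.
    by apply: edge_dvdD; apply: absorbing_root.
  apply/mnm_lepP => j; rewrite !mnmDE addnA leq_add2r.
  apply: leq_trans (leq_addl _ _); move: j; apply/mnm_lepP.
  exact: roots_mon_le (comp_in_components _ _) bip.
(* The component of [i a] need not be [N], so the square of the monomial is used: both [i a] and
   [r N] carry closed odd walks, and each of the two copies of [M] absorbs one of them. *)
have ii : odd_walk G (i a) (i a).
  by apply: nonbipartite_odd_walk nbip; rewrite ?comp_in_components ?mem_comp.
have NN : odd_walk G (r N) (r N).
  by apply: nonbipartite_odd_walk Nnbip; rewrite ?root_mem.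
apply: edge_dvd_le (edge_dvdD (Modd _ _ ii) (Modd _ _ NN)).
apply/mnm_lepP => j; move/mnm_lepP: mN => /(_ j).
by rewrite !mnmDE; lia.
Qed.

End UpperBounds.

(** * Lower bounds *)

Section LowerBounds.
Variables (n : nat) (G : sgraph n) (K : fieldType).
Implicit Types (I p : {mpoly K[n]} -> Prop) (f g : {mpoly K[n]}).

Lemma prime_ideal_X p g k : is_prime_ideal p -> p (g ^+ k) -> p g.
Proof.
case=> _ p1 pM; elim: k => [|k IH]; first by rewrite expr0.
by rewrite exprS => /pM[].
Qed.

(** The [k]-th power of the edge monomial lies in [I], hence in the prime [p]. *)
Lemma prime_colon_edge I p f k x y : is_prime_ideal p ->
  (forall g, colon I f g <-> p g) -> (forall g, edge_pow G k g -> I g) -> G x y ->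
  p 'X_x \/ p 'X_y.
Proof.
move=> pp If Ik Gxy; have [_ _ pM] := pp.
apply/pM/(prime_ideal_X (k := k)) => //; apply/If/Ik.
rewrite -[k]addn0; apply: edge_powM; last exact: edge_pow0.
rewrite -mpolyXD mpolyXn /edge_pow supp_inX; apply/edge_dvdP.
exists (nseq k (x, y)); rewrite size_nseq; split=> //.
  by rewrite /edges all_nseq /= Gxy orbT.
elim: (k) => [|l IH]; first by rewrite emon_nil lepm_refl.
rewrite mulmS emon_cons; apply/mnm_lepP => j; rewrite !mnmDE leq_add2l.
by move: j; apply/mnm_lepP.
Qed.

Lemma edge_pow_integral_closure k g : edge_pow G k g ->
  integral_closure (ideal_pow (edge_ideal G K) k) g.
Proof.
move=> gk; exists 1, (fun=> - g); split=> //; last first.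
  by rewrite big_nat1 expr1 expr0 mulr1 subrr.
move=> i /andP[i0 i1]; have -> : i = 1 by lia.
by apply/edge_ideal_pow_powE; rewrite muln1 /edge_pow supp_inN.
Qed.

(** The prime contains some variable, whose product with [f] lies in the closure. With all weights
    equal to 1, that product has order at least [2 * k], while its degree is [d + 1]. *)
Lemma integral_closure_witness_ge k d x y : G x y ->
  vnumber_witness (integral_closure (ideal_pow (edge_ideal G K) k)) d ->
  (2 * k - 1 <= d)%N.
Proof.
move=> Gxy [f [p [fd [pp _] If]]]; have [_ p1 _] := pp.
have f0 : f != 0.
  apply/eqP => f0; apply/p1/If; rewrite /colon f0 mulr0.
  exact/edge_pow_integral_closure/supp_in0.
have [z pz] : exists z, p 'X_z.
  have [] := prime_colon_edge pp If (@edge_pow_integral_closure k) Gxy.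
    by exists x.
  by exists y.
have {pz} : wt_ge (fun=> 1%N) (2 * k) ('X_z * f).
  move/If: pz; rewrite /colon; apply: wt_ge_integral_closure => g /edge_ideal_powE.
  apply: sub_supp_in => m /edge_dvdP[s [<- se sm]] /=; apply: leq_trans (wt_le _ sm).
  by rewrite (wt_emon (G := G) (P := predT)) ?count_predT.
rewrite mulrC /wt_ge supp_in_MX => /allP /(_ _ (mlead_supp f0)) /=.
rewrite wtD wtU; have -> : wt (fun=> 1%N) (mlead f) = d.
  move/dhomogP: fd => /(_ _ (mlead_supp f0)) <-; rewrite /= mdegE.
  by apply: eq_bigr => i _; rewrite mul1n.
by lia.
Qed.

Lemma emon_filter_notin C s i : C \in components G -> edges G s -> i \in C ->
  emon [seq e <- s | ~~ in_comp C e] i = 0%N.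
Proof.
move=> Cc se iC; rewrite /emon mnm_sumE big_filter big_seq_cond.
rewrite big1 // => -[x y] /andP[/(allP se) /= Gxy nx].
have ny : y \notin C.
  by move: nx; rewrite /in_comp /= !(mem_component _ Cc) (edge_comp Gxy).
rewrite mnmDE !mnm1E /=; apply/eqP; rewrite addn_eq0 !eqb0.
by apply/andP; split; [apply: contraNneq nx => -> | apply: contraNneq ny => ->].
Qed.

Lemma emon_filter_in C s i : C \in components G -> edges G s -> i \notin C ->
  emon [seq e <- s | in_comp C e] i = 0%N.
Proof.
move=> Cc se iC; rewrite /emon mnm_sumE big_filter big_seq_cond.
rewrite big1 // => -[x y] /andP[/(allP se) /= Gxy xC].
have yC : y \in C.
  by move: xC; rewrite /in_comp /= !(mem_component _ Cc) (edge_comp Gxy).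
rewrite mnmDE !mnm1E /=; apply/eqP; rewrite addn_eq0 !eqb0.
by apply/andP; split; [apply: contraNneq iC => <- | apply: contraNneq iC => <-].
Qed.

Lemma emon_filter_le (a : pred ('I_n * 'I_n)) s : (emon (filter a s) <= emon s)%MM.
Proof.
elim: s => [|e s IH] /=; first exact: lepm_refl.
rewrite emon_cons; case: (a e); last exact: lepm_trans IH (lem_addl _ _).
by rewrite emon_cons; apply/mnm_lepP => j; rewrite !mnmDE leq_add2l; move/mnm_lepP: IH.
Qed.

(* Exchange: if the edges of [t] inside [C] were at least as many as those of
   [s], they could replace them, giving a product of [size s] edges below [m]. *)
Lemma component_exchange C k m s t x z : C \in components G ->
  ~~ edge_dvd G k m -> edges G s -> edges G t -> size s = k ->
  x \in C -> z \notin C -> (emon s <= U_(x) + m)%MM -> (emon t <= U_(z) + m)%MM ->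
  (count (in_comp C) t < count (in_comp C) s)%N.
Proof.
move=> Cc nm se te sk xC zC sm tm; rewrite ltnNge; apply: contra nm => st.
pose u := [seq e <- s | ~~ in_comp C e] ++ [seq e <- t | in_comp C e].
have ue : edges G u.
  rewrite edges_cat; apply/andP; split; apply/allP => e; rewrite mem_filter.
    by case/andP=> _; apply: (allP se).
  by case/andP=> _; apply: (allP te).
have um : (emon u <= m)%MM.
  apply/mnm_lepP => i; rewrite emon_cat mnmDE; have [iC|iC] := boolP (i \in C).
    rewrite emon_filter_notin // add0n.
    have := elimT mnm_lepP (lepm_trans (emon_filter_le (in_comp C) t) tm) i.
    by rewrite mnmDE mnm1E; case: eqP iC zC => [-> -> //|_ _ _]; rewrite add0n.
  rewrite emon_filter_in // addn0.
  have := elimT mnm_lepP (lepm_trans (emon_filter_le (predC (in_comp C)) s) sm) i.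
  by rewrite mnmDE mnm1E; case: eqP iC xC => [-> /negPf -> //|_ _ _]; rewrite add0n.
have ku : (k <= size u)%N.
  rewrite size_cat !size_filter -sk -(count_predC (in_comp C) s) addnC.
  by rewrite leq_add2l.
apply/edge_dvdP; exists (take k u); rewrite size_takel //; split=> //.
  by move: ue; rewrite -{1}(cat_take_drop k u) edges_cat => /andP[].
apply: lepm_trans um; rewrite -{2}(cat_take_drop k u) emon_cat.
exact: lem_addr.
Qed.

(** Let [N C] count the edges inside [C] of a product dividing [x C] times [m]. Exchange against a
    fixed component [D] bounds the sum of the [N C] below by [k + c - 1], where [c] is the number of
    components. Comparing degrees inside each [C] bounds twice that sum above by [mdeg m + c]. *)
Lemma component_degree_bound k m (x : {set 'I_n} -> 'I_n) : ~~ edge_dvd G k m ->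
  (forall C, C \in components G -> x C \in C /\ edge_dvd G k (U_(x C) + m)%MM) ->
  (0 < num_components G)%N -> (2 * k + num_components G - 2 <= mdeg m)%N.
Proof.
move=> nm xP c0.
have /fin_all_exists[s sP] (C : {set 'I_n}) : exists s, C \in components G ->
    [/\ size s = k, edges G s & (emon s <= U_(x C) + m)%MM].
  have [Cc|_] := boolP (C \in components G); last by exists [::].
  by have [_ /edge_dvdP[s sP]] := xP C Cc; exists s.
have [D Dc] : exists D, D \in components G by apply/card_gt0P.
pose N C := count (in_comp C) (s C).
have degC C : C \in components G -> (2 * N C <= \sum_(i in C) m i + 1)%N.
  move=> Cc; have [_ se sm] := sP C Cc; pose u (i : 'I_n) : nat := i \in C.
  have := wt_le u sm; rewrite (wt_emon (G := G) (P := in_comp C)) //; last first.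
    move=> y z Gyz; rewrite /u /in_comp /= !(mem_component _ Cc) (edge_comp Gyz).
    by rewrite mul2n addnn.
  move=> /leq_trans; apply; rewrite wtD wtU addnC leq_add //; last first.
    by rewrite /u; case: (_ \in _).
  rewrite /wt [X in (_ <= X)%N]big_mkcond /=; apply: leq_sum => i _; rewrite /u.
  by case: (i \in C); rewrite ?mul1n ?mul0n.
have degsum : (\sum_(C in components G) \sum_(i in C) m i = mdeg m)%N.
  transitivity (\sum_(C in components G) \sum_i (i \in C) * m i)%N.
    apply: eq_bigr => C _; rewrite big_mkcond; apply: eq_bigr => i _.
    by case: (i \in C); rewrite ?mul1n.
  rewrite mdegE exchange_big /=; apply: eq_bigr => i _.
  by rewrite -big_distrl /= sum_mem_component mul1n.
have Nsum : (k + num_components G - 1 <= \sum_(C in components G) N C)%N.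
  have [sDk De Dm] := sP D Dc.
  have xD := (xP D Dc).1.
  rewrite -sDk -(sum_count_component G (s D)).
  rewrite (bigD1 D) //= [X in (_ <= X)%N](bigD1 D) //=.
  rewrite /num_components (cardD1 D) Dc.
  suff : (\sum_(C in components G | C != D) count (in_comp C) (s D) +
      #|[predD1 components G & D]| <= \sum_(C in components G | C != D) N C)%N.
    by rewrite add1n addnS subn1 /= -addnA leq_add2l.
  have -> : (#|[predD1 components G & D]| = \sum_(C in components G | C != D) 1)%N.
    by rewrite -sum1_card; apply: eq_bigl => C; rewrite !inE andbC.
  (* Each component other than [D] gains one edge over its share of [s D]. *)
  rewrite -big_split /=; apply: leq_sum => C /andP[Cc CD]; rewrite addn1.
  have [sCk Ce Cm] := sP C Cc.
  apply: (component_exchange Cc nm Ce De sCk (xP C Cc).1 _ Cm Dm).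
  by move: xD; rewrite (mem_component _ Dc) (mem_component _ Cc) => /eqP <-.
have : (2 * \sum_(C in components G) N C <= mdeg m + num_components G)%N.
  rewrite -degsum big_distrr /= /num_components -sum1_card -big_split /=.
  by apply: leq_sum => C /degC.
by lia.
Qed.

(** By [hiso]-type nonisolation every component has an edge, so the prime contains a variable from
    each component. As the power is a monomial ideal, that variable times any monomial of [f] lies
    in it. *)
Lemma edge_ideal_pow_witness_ge k d : no_isolated G -> (0 < num_components G)%N ->
  vnumber_witness (ideal_pow (edge_ideal G K) k) d ->
  (2 * k + num_components G - 2 <= d)%N.
Proof.
move=> iso c0 [f [p [fd [pp _] If]]]; have [_ p1 _] := pp.
have {}If g : edge_pow G k (g * f) <-> p g by rewrite -edge_ideal_powE; apply: If.
have : ~~ edge_pow G k f by apply/negP => fk; apply/p1/If; rewrite mul1r.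
move=> /allPn[m mf nm]; have <- : mdeg m = d by move/dhomogP: fd; apply.
have /fin_all_exists[x xP] (C : {set 'I_n}) : exists x,
    C \in components G -> x \in C /\ edge_dvd G k (U_(x) + m)%MM.
  have [Cc|_] := boolP (C \in components G); last first.
    by have /card_gt0P[? /componentsP[x _]] := c0; exists x.
  have /componentsP[x CE] := Cc; have [y Gxy] := iso x.
  have [z zC pz] : exists2 z, z \in C & p 'X_z.
    have [px|py] := prime_colon_edge (I := edge_pow G k) pp If (fun _ => id) Gxy.
      by exists x; rewrite // CE mem_comp.
    by exists y; rewrite // CE (edge_comp Gxy) mem_comp.
  exists z => _; split=> //; move/If: pz; rewrite mulrC /edge_pow supp_in_MX.
  by move/allP/(_ _ mf); rewrite addmC.
exact: component_degree_bound nm xP c0.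
Qed.

End LowerBounds.

(** * Existence of the minimum and combination of the bounds *)

(** Being a witness degree is not a decidable property, so the least one is obtained classically. *)
Lemma least_nat (P : nat -> Prop) d : P d ->
  exists2 m, P m & (m <= d)%N /\ forall d', P d' -> (m <= d')%N.
Proof.
elim/ltn_ind: d => d IH Pd.
have [[e [ed Pe]]|nmin] := classic (exists e, (e < d)%N /\ P e).
  have [m Pm [me mmin]] := IH e ed Pe; exists m => //; split=> //.
  exact: leq_trans me (ltnW ed).
exists d => //; split=> // e Pe; rewrite leqNgt; apply/negP => ed.
by apply: nmin; exists e.
Qed.

Lemma num_components_split n (G : sgraph n) :
  num_components G = (num_bipartite G + num_nonbipartite G)%N.
Proof.
rewrite /num_components -(cardsID [set C | bipartite_on G C]).
by congr (_ + _)%N; apply: eq_card => C; rewrite !inE // andbC.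
Qed.

Theorem theorem4p5 (K : fieldType) (n : nat) (G : sgraph n)
    (hdisc : disconnected G) (hiso : no_isolated G)
    (hr : (1 <= num_nonbipartite G)%N) :
  exists k0 : nat, forall k : nat, (k0 <= k)%N ->
    exists vbar v : nat,
      [/\ is_vnumber (integral_closure (ideal_pow (edge_ideal G K) k)) vbar,
          is_vnumber (ideal_pow (edge_ideal G K) k) v,
          (2 * k - 1 <= vbar)%N,
          (vbar <= 2 * k + num_bipartite G - 1)%N
        & (2 * k + num_bipartite G - 1 <= v)%N /\
          v = (2 * k + num_components G - 2)%N].
Proof.
have /card_gt0P[N] := hr; rewrite inE => /andP[Nc Nnbip].
have /componentsP[x0 _] := Nc; have [y0 Gxy] := hiso x0.
have /fin_all_exists[r rP] (C : {set 'I_n}) : exists x, C \in components G -> x \in C.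
  have [/componentsP[x ->]|_] := boolP (C \in components G).
    by exists x => _; exact: mem_comp.
  by exists x0.
have [M0 M0abs] := absorbing_exists G.
exists (size M0).+1 => -[//|k] Mk.
have [M Mabs Msize] := absorbing_size M0abs Gxy Mk.
have cE := num_components_split G.
have := integral_closure_witness K rP Mabs Nc Nnbip.
rewrite Msize => /least_nat[vbar vP [vle vmin]].
have := edge_ideal_pow_witness K rP Mabs; rewrite Msize => wit.
(* The exponent is now [k.+1], so this value is [2 * k.+1 + num_components G - 2]. *)
exists vbar, (2 * k + num_components G)%N; split=> //.
- split=> // d /edge_ideal_pow_witness_ge -/(_ hiso); rewrite cE; lia.
- exact: integral_closure_witness_ge Gxy vP.
- lia.
(* The inequality uses [hr]: a non-bipartite component makes the number of components exceed
   [num_bipartite G]. *)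
- rewrite cE; split; lia.
Qed.
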